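(* Let $q:I\times J\to\mathbb{R}^3$ be a normalized discrete improper indefinite affine sphere (DIIAS). Then $q$ is affinely congruent to a discrete Cayley surface if and only if $A\neq0$ and $A_1=0$ (i.e. the cubic form coefficient $A=A(u)$ is a non-zero constant).
   Context: Notation: $I,J\subset\mathbb{Z}$ are sets of consecutive integers, $I$ with at least three elements and $J$ with at least two; $[\cdot,\cdot,\cdot]$ is the determinant in $\mathbb{R}^3$. For a net $q:I\times J\to\mathbb{R}^3$: $q_1(u+\tfrac12,v)=q(u+1,v)-q(u,v)$, $q_2(u,v+\tfrac12)=q(u,v+1)-q(u,v)$, $q_{11}(u,v)=q_1(u+\tfrac12,v)-q_1(u-\tfrac12,v)$, $q_{22}(u,v)=q_2(u,v+\tfrac12)-q_2(u,v-\tfrac12)$, $q_{12}(u+\tfrac12,v+\tfrac12)=q(u+1,v+1)-q(u,v+1)-q(u+1,v)+q(u,v)$. The net is asymptotic if for every $(u,v)$ the vectors $q_1(u\pm\tfrac12,v)$, $q_2(u,v\pm\tfrac12)$ (those that are defined) are coplanar (span at most a 2-dimensional linear space); one assumes $M(u+\tfrac12,v+\tfrac12)=[q_1(u+\tfrac12,v),q_2(u,v+\tfrac12),q_{12}(u+\tfrac12,v+\tfrac12)]>0$ on every quadrangle, and also the coplanarity of the four vectors at each interior vertex. The metric is $\Omega=\sqrt{M}$ and the affine normal is $\xi=q_{12}/\Omega$ (both defined on quadrangles). The asymptotic net is a DIIAS if $\xi$ is constant. One takes $\xi=(0,0,1)$. The cubic form coefficient is $A(u,v)=[q_1(u-\tfrac12,v),q_1(u+\tfrac12,v),\xi]$,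 which does not depend on $v$; $A_1(u+\tfrac12)=A(u+1)-A(u)$. A DIIAS is normalized if $\Omega=1$ on every quadrangle and $q_{22}=(0,0,0)$ everywhere; then its structural equations are $q_{11}(u,v)=A(u)\,q_2(u,v+\tfrac12)$, $q_{12}=(0,0,1)$, $q_{22}=(0,0,0)$. A discrete Cayley surface is the net $c^a(u,v)=\left(u,\;v+\tfrac{a\,u(u-1)}{2},\;uv+\tfrac{a\,u(u^2-1)}{6}\right)$, $(u,v)\in\mathbb{Z}^2$, for a constant $a\neq0$. ''Affinely congruent'' means that there are $a\ne 0$ and an invertible affine map $T$ of $\mathbb{R}^3$ with $T(q(u,v))=c^a(u,v)$ for all $(u,v)\in I\times J$. *)

(* Defs.v *)
From mathcomp Require Import all_boot all_order all_algebra.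
From mathcomp Require Import all_classical all_reals.
From mathcomp Require Import normedtype.

Set Implicit Arguments.
Unset Strict Implicit.
Unset Printing Implicit Defensive.

Import Order.TTheory GRing.Theory Num.Theory.

Local Open Scope ring_scope.
Local Open Scope classical_set_scope.
Local Open Scope card_scope.

(* A net on I x J is represented by a total function int -> int -> 'rV[R]_3;
   its values outside I x J are irrelevant: every condition below is guarded
   so that only points of I x J are evaluated.
   Half-integer positions are encoded by their lower integer neighbours: the
   edge (u + 1/2, v), the edge (u, v + 1/2) and the quadrangle
   (u + 1/2, v + 1/2) are all indexed by (u, v). *)

Definition consecutive_integers (I : set int) : Prop := is_interval I.

Definition inner (I : set int) (u : int) : Prop :=
  [/\ I (u - 1), I u & I (u + 1)].

Definition quadrangle (I J : set int) (u v : int) : Prop :=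
  [/\ I u, I (u + 1), J v & J (v + 1)].

Section Nets.
Variable R : realType.
Implicit Types (I J : set int) (q : int -> int -> 'rV[R]_3) (u v : int).

Definition vec3 (x y z : R) : 'rV[R]_3 := \row_(i < 3) [:: x; y; z]`_i.

Definition det3 (x y z : 'rV[R]_3) : R :=
  \det (\matrix_(i < 3) [:: x; y; z]`_i).

Definition q1 q u v : 'rV[R]_3 := q (u + 1) v - q u v.

Definition q2 q u v : 'rV[R]_3 := q u (v + 1) - q u v.

Definition q22 q u v : 'rV[R]_3 := q2 q u v - q2 q u (v - 1).

Definition q12 q u v : 'rV[R]_3 :=
  q (u + 1) (v + 1) - q u (v + 1) - q (u + 1) v + q u v.

(* The vectors q_1(u + 1/2, v), q_1(u - 1/2, v), q_2(u, v + 1/2) and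
   q_2(u, v - 1/2), omitting those that leave the domain. *)
Definition star I J q u v : seq 'rV[R]_3 :=
  (if u + 1 \in I then [:: q1 q u v] else [::]) ++
  (if u - 1 \in I then [:: q1 q (u - 1) v] else [::]) ++
  (if v + 1 \in J then [:: q2 q u v] else [::]) ++
  (if v - 1 \in J then [:: q2 q u (v - 1)] else [::]).

Definition asymptotic_net I J q : Prop :=
  forall u v, I u -> J v -> (\dim <<star I J q u v>>%VS <= 2)%N.

Definition M q u v : R := det3 (q1 q u v) (q2 q u v) (q12 q u v).

Definition metric q u v : R := Num.sqrt (M q u v).

Definition affine_normal q u v : 'rV[R]_3 := (metric q u v)^-1 *: q12 q u v.

Definition DIIAS I J q : Prop :=
  [/\ asymptotic_net I J q,
      forall u v, quadrangle I J u v -> 0 < M q u v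
    & exists xi, forall u v, quadrangle I J u v -> affine_normal q u v = xi].

Definition e3 : 'rV[R]_3 := vec3 0 0 1.

Definition normalized_DIIAS I J q : Prop :=
  [/\ DIIAS I J q,
      forall u v, quadrangle I J u v -> affine_normal q u v = e3,
      forall u v, quadrangle I J u v -> metric q u v = 1
    & forall u v, I u -> inner J v -> q22 q u v = 0].

(* Meaningful for u inner in I; for a DIIAS with affine normal e3 it does not
   depend on v. *)
Definition cubic_coeff q u v : R := det3 (q1 q (u - 1) v) (q1 q u v) e3.

Definition cubic_coeff_1 q u v : R := cubic_coeff q (u + 1) v - cubic_coeff q u v.

Definition cayley (a : R) u v : 'rV[R]_3 :=
  let x : R := u%:~R in
  let y : R := v%:~R in
  vec3 x (y + a * x * (x - 1) / 2) (x * y + a * x * (x ^+ 2 - 1) / 6).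

Definition invertible_affine (T : 'rV[R]_3 -> 'rV[R]_3) : Prop :=
  exists L : 'M[R]_3, exists b : 'rV[R]_3,
    L \in unitmx /\ forall x, T x = x *m L + b.

Definition congruent_to_Cayley I J q : Prop :=
  exists a : R, a != 0 /\
  exists T, invertible_affine T /\
    forall u v, I u -> J v -> T (q u v) = cayley a u v.

End Nets.

(* Main.v *)
(** The structural equations q_12 = e3, q_22 = 0 and q_11 = A q_2 hold both for
    q and for the Cayley surface c^a, the latter with A = a.  Coplanarity of the
    vector star gives the third one, by Cramer's rule in the frame
    (q_1, q_2, e3), whose determinant is 1.

    If q is affinely congruent to c^a, the linear part of the congruence sends
    the frame (q_1, q_2, e3) to (c_1, c_2, e3); it therefore has determinant 1
    and fixes e3, so it preserves the cubic form coefficient.  Conversely, if A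
    is a constant a, take the affine map sending one vertex and its frame to
    those of c^a: the difference of the two nets solves a homogeneous linear
    recursion with zero initial data. *)

Require Import Defs.
From mathcomp Require Import all_boot all_order all_algebra.
From mathcomp Require Import all_classical all_reals.
From mathcomp Require Import ring zify.

Import Order.TTheory GRing.Theory Num.Theory.

Local Open Scope ring_scope.
Local Open Scope classical_set_scope.
Local Open Scope card_scope.

(** * Induction on sets of consecutive integers *)

Section IntegerIntervals.
Implicit Types (K : set int) (k : int).

(** The cardinality bound gives two distinct points of [K]; the smaller one starts an edge, by
    convexity. *)
Lemma edge_exists {K} : consecutive_integers K -> `I_2 #<= K ->
  exists k, K k /\ K (k + 1).
Proof.
move=> hK /pcard_surjP[g gK].
have [x0 K0 g0] := gK 0%N isT.
have [x1 K1 g1] := gK 1%N isT.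
have ne01 : x0 != x1 by apply/eqP => e; move: g1; rewrite -e g0.
have [lt01|le10] := ltP x0 x1.
- by exists x0; split=> //; apply: (hK _ _ K0 K1); lia.
- by exists x1; split=> //; apply: (hK _ _ K1 K0); lia.
Qed.

Lemma inner_exists {K} : consecutive_integers K -> `I_3 #<= K ->
  exists k, inner K k.
Proof.
move=> hK /pcard_surjP[g gK].
have [x0 K0 g0] := gK 0%N isT.
have [x1 K1 g1] := gK 1%N isT.
have [x2 K2 g2] := gK 2%N isT.
have ne01 : x0 != x1 by apply/eqP => e; move: g1; rewrite -e g0.
have ne02 : x0 != x2 by apply/eqP => e; move: g2; rewrite -e g0.
have ne12 : x1 != x2 by apply/eqP => e; move: g2; rewrite -e g1.
have between x y z : K x -> K z -> x < y < z -> exists k, inner K k.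
  by move=> Kx Kz xyz; exists y; split; apply: (hK _ _ Kx Kz); lia.
(* Six orderings of the three points remain; in each the middle one is inner. *)
have [|] := ltP x0 x1; have [|] := ltP x1 x2;
  have [|] := ltP x0 x2 => l02 l12 l01; try lia.
- by apply: (between _ x1 _ K0 K2); lia.
- by apply: (between _ x2 _ K0 K1); lia.
- by apply: (between _ x0 _ K2 K1); lia.
- by apply: (between _ x0 _ K1 K2); lia.
- by apply: (between _ x2 _ K1 K0); lia.
- by apply: (between _ x1 _ K2 K0); lia.
Qed.

(** The step is an equivalence because the induction runs both ways from [k0], downwards by its
    converse. *)
Lemma interval_ind {K} {P : int -> Prop} k0 : consecutive_integers K ->
  K k0 -> P k0 -> (forall k, K k -> K (k + 1) -> P k <-> P (k + 1)) ->
  forall k, K k -> P k.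
Proof.
move=> hK K0 P0 Pstep k Kk.
have [le0|lt0] := leP k0 k.
- have [n kE] : exists n : nat, k = k0 + n%:Z by exists `|k - k0|%N; lia.
  have : k0 + n%:Z <= k by lia.
  rewrite [X in P X]kE {kE}.
  elim: n => [|n IHn] le; first by rewrite addr0.
  rewrite (_ : k0 + n.+1%:Z = k0 + n%:Z + 1); last by lia.
  have Kn : K (k0 + n%:Z) by apply: (hK _ _ K0 Kk); lia.
  have Kn1 : K (k0 + n%:Z + 1) by apply: (hK _ _ K0 Kk); lia.
  by apply/(Pstep _ Kn Kn1)/IHn; lia.
- have [n kE] : exists n : nat, k = k0 - n%:Z by exists `|k - k0|%N; lia.
  have : k <= k0 - n%:Z by lia.
  rewrite [X in P X]kE {kE}.
  elim: n => [|n IHn] le; first by rewrite subr0.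
  have En : k0 - n.+1%:Z + 1 = k0 - n%:Z by lia.
  have Kn : K (k0 - n.+1%:Z) by apply: (hK _ _ Kk K0); lia.
  have Kn1 : K (k0 - n.+1%:Z + 1) by apply: (hK _ _ Kk K0); lia.
  by apply/(Pstep _ Kn Kn1); rewrite En; apply: IHn; lia.
Qed.

Lemma second_difference_eq0 {K} {V : zmodType} {f : int -> V} k0 :
  consecutive_integers K -> K k0 -> K (k0 + 1) -> f k0 = 0 -> f (k0 + 1) = 0 ->
  (forall k, inner K k -> f (k + 1) - f k = f k - f (k - 1)) ->
  forall k, K k -> f k = 0.
Proof.
move=> hK K0 K1 f0 f1 fK.
(* [K'] indexes the edges of [K] by their lower ends. The first difference of [f] is constant along
   it and vanishes at [k0], so [f] is constant too. *)
pose K' := [set k | K k /\ K (k + 1)].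
have hK' : consecutive_integers K'.
  move=> x y [Kx Kx1] [Ky Ky1] z xzy.
  by split; apply: (hK _ _ Kx Ky1); lia.
have df k : K' k -> f (k + 1) - f k = 0.
  move: k; apply: (interval_ind k0 hK') => //; first by rewrite f0 f1 subr0.
  move=> k [Kk Kk1] [_ Kk2].
  have Ik1 : inner K (k + 1) by split=> //; rewrite addrK.
  by rewrite (fK _ Ik1) addrK.
apply: (interval_ind k0 hK) => // k Kk Kk1.
by have /subr0_eq -> := df k (conj Kk Kk1).
Qed.

Lemma inner_interval {K} :
  consecutive_integers K -> consecutive_integers (inner K).
Proof.
move=> hK x y [Kx Kx0 Kx1] [Ky Ky0 Ky1] z xzy.
by split; apply: (hK _ _ Kx Ky1); lia.
Qed.

End IntegerIntervals.

(** * Determinants of three vectors *)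

Section Det3.
Variable R : realType.
Implicit Types x y z w : 'rV[R]_3.

Lemma det3E x y z : det3 x y z =
  x 0 0 * (y 0 1 * z 0 2 - y 0 2 * z 0 1)
  - x 0 1 * (y 0 0 * z 0 2 - y 0 2 * z 0 0)
  + x 0 2 * (y 0 0 * z 0 1 - y 0 1 * z 0 0).
Proof.
rewrite /det3 (expand_det_row _ 0) !big_ord_recl big_ord0 /cofactor.
rewrite !(expand_det_row _ 0) !big_ord_recl !big_ord0 /cofactor !det_mx11 !mxE.
(* Indexing coordinates by naturals lets the ordinals produced by the cofactor expansion compute, so
   that [ring] identifies equal coordinates. *)
pose c (v : 'rV[R]_3) n : R := v 0 (inord n).
have cE (v : 'rV[R]_3) i : v 0 i = c v i by rewrite /c inord_val.
rewrite !cE; move: c {cE} => c; rewrite /bump /=; ring.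
Qed.

Lemma row3P x y : x 0 0 = y 0 0 -> x 0 1 = y 0 1 -> x 0 2 = y 0 2 -> x = y.
Proof.
move=> h0 h1 h2; apply/rowP; case=> [[|[|[|//]]] h].
- by rewrite (_ : Ordinal h = 0) //; apply: val_inj.
- by rewrite (_ : Ordinal h = 1) //; apply: val_inj.
- by rewrite (_ : Ordinal h = 2) //; apply: val_inj.
Qed.

Lemma cramer3 x y z w :
  det3 x y z *: w = det3 w y z *: x + det3 x w z *: y + det3 x y w *: z.
Proof. by apply: row3P; rewrite !mxE !det3E; ring. Qed.

(** Were the determinant nonzero, Cramer's rule would put every vector in [U]. *)
Lemma det3_eq0 (U : {vspace 'rV[R]_3}) x y z : (\dim U <= 2)%N ->
  x \in U -> y \in U -> z \in U -> det3 x y z = 0.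
Proof.
move=> dimU Ux Uy Uz; apply/eqP; apply: contraTT dimU => det_neq0.
rewrite -ltnNge (_ : U = fullv) ?dimvf //.
apply/eqP; rewrite eqEsubv subvf; apply/subvP => w _.
rewrite -[w]scale1r -(mulVf det_neq0) -scalerA cramer3.
by rewrite memvZ // !memvD ?memvZ.
Qed.

Lemma det3_mulmx x y z (L : 'M[R]_3) :
  det3 (x *m L) (y *m L) (z *m L) = det3 x y z * \det L.
Proof.
rewrite /det3 -det_mulmx; congr (\det _); apply/row_matrixP => i.
rewrite row_mul !rowK.
by case: i => [[|[|[|//]]] ?].
Qed.

End Det3.

(** * Structural equations of the Cayley surface *)

Section Cayley.
Variables (R : realType) (a : R).
Implicit Types u v : int.

Let vec3E0 (x y z : R) : vec3 x y z 0 0 = x. Proof. by rewrite !mxE. Qed.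
Let vec3E1 (x y z : R) : vec3 x y z 0 1 = y. Proof. by rewrite !mxE. Qed.
Let vec3E2 (x y z : R) : vec3 x y z 0 2 = z. Proof. by rewrite !mxE. Qed.
Let coordB (x y : 'rV[R]_3) i : (x - y) 0 i = x 0 i - y 0 i.
Proof. by rewrite !mxE. Qed.
Let coordD (x y : 'rV[R]_3) i : (x + y) 0 i = x 0 i + y 0 i.
Proof. by rewrite !mxE. Qed.
Let coordZ (x : 'rV[R]_3) i : (a *: x) 0 i = a * x 0 i.
Proof. by rewrite !mxE. Qed.
Let coord0 i : (0 : 'rV[R]_3) 0 i = 0.
Proof. by rewrite !mxE. Qed.
(** Passes to coordinates and pushes integer casts inwards, leaving identities for [field]. *)
Let coordE := (coordB, coordD, coordZ, coord0, vec3E0, vec3E1, vec3E2,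
  intrB, intrD, mulr1z).

Lemma cayley_q12 u v : q12 (cayley a) u v = e3 R.
Proof. by apply: row3P; rewrite /q12 /e3 /cayley !coordE; field. Qed.

Lemma cayley_q22 u v : q22 (cayley a) u v = 0.
Proof. by apply: row3P; rewrite /q22 /q2 /cayley !coordE; field. Qed.

Lemma cayley_q11 u v :
  q1 (cayley a) u v - q1 (cayley a) (u - 1) v = a *: q2 (cayley a) u v.
Proof. by apply: row3P; rewrite /q1 /q2 /cayley !coordE; field. Qed.

Lemma cayley_det u v :
  det3 (q1 (cayley a) u v) (q2 (cayley a) u v) (e3 R) = 1.
Proof. by rewrite det3E /q1 /q2 /e3 /cayley !coordE; field. Qed.

Lemma cayley_cubic_coeff u v : cubic_coeff (cayley a) u v = a.
Proof. by rewrite /cubic_coeff det3E /q1 /e3 /cayley !coordE; field. Qed.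

End Cayley.

(** * Structural equations and uniqueness for nets *)

Section NormalizedNets.
Context {R : realType} {I J : set int}.
Implicit Types (q d : int -> int -> 'rV[R]_3) (u v : int).

Lemma normalized_q12 {q} : normalized_DIIAS I J q ->
  forall u v, quadrangle I J u v -> q12 q u v = e3 R.
Proof.
move=> [_ xi metric1 _] u v uv.
by rewrite -(xi _ _ uv) /affine_normal metric1 // invr1 scale1r.
Qed.

(** With [q12 = e3] this determinant is [M]. Positivity of [M] makes it the square of the metric. *)
Lemma normalized_det {q} : normalized_DIIAS I J q ->
  forall u v, quadrangle I J u v -> det3 (q1 q u v) (q2 q u v) (e3 R) = 1.
Proof.
move=> hq u v uv; rewrite -(normalized_q12 hq _ _ uv).
have [[_ Mpos _] _ metric1 _] := hq.
have := sqr_sqrtr (ltW (Mpos _ _ uv)).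
by rewrite -/(metric q u v) metric1 // expr1n.
Qed.

Lemma normalized_q11 {q} : normalized_DIIAS I J q ->
  forall u v, inner I u -> J v -> J (v + 1) ->
  q1 q u v - q1 q (u - 1) v = cubic_coeff q u v *: q2 q u v.
Proof.
move=> hq u v [Iu' Iu Iu1] Jv Jv1.
have Q : quadrangle I J u v by split.
have Q' : quadrangle I J (u - 1) v by split=> //; rewrite subrK.
have det1 := normalized_det hq _ _ Q.
have det1' := normalized_det hq _ _ Q'.
have q2' : q2 q u v = q2 q (u - 1) v + e3 R.
  rewrite -(normalized_q12 hq _ _ Q') /q12 /q2 subrK.
  by apply/rowP => i; rewrite !mxE; ring.
have coplanar : det3 (q1 q u v) (q2 q u v) (q1 q (u - 1) v) = 0.
  have [[/(_ _ _ Iu Jv) dim_star _ _] _ _ _] := hq.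
  apply: (det3_eq0 _ _ _ _ _ dim_star); apply: memv_span;
    by rewrite /star (mem_set Iu1) (mem_set Iu') (mem_set Jv1) !mem_cat !inE eqxx ?orbT.
(* The coefficients of [q1 q (u - 1) v] in the frame at [(u, v)] are 1, minus the cubic coefficient,
   and 0. The first uses that [q2] changes only by [e3] from [u - 1] to [u]. *)
have := cramer3 _ (q1 q u v) (q2 q u v) (e3 R) (q1 q (u - 1) v).
rewrite det1 coplanar scale1r scale0r addr0.
rewrite (_ : det3 (q1 q (u - 1) v) _ _ = 1); last first.
  by rewrite -det1' q2' !det3E !mxE; ring.
rewrite (_ : det3 (q1 q u v) _ _ = - cubic_coeff q u v); last first.
  by rewrite /cubic_coeff !det3E; ring.
by move=> ->; rewrite scale1r scaleNr opprB addrC subrK.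
Qed.

(** Vanishing [q12] carries [q2 = 0] along the row [v0]. There the second difference in [u] is then
    zero, so [d] vanishes on that row, and [q22 = 0] spreads this along each column. *)
Lemma net_eq0 {d} a u0 v0 :
  consecutive_integers I -> consecutive_integers J -> quadrangle I J u0 v0 ->
  d u0 v0 = 0 -> d (u0 + 1) v0 = 0 -> d u0 (v0 + 1) = 0 ->
  (forall u v, quadrangle I J u v -> q12 d u v = 0) ->
  (forall u v, I u -> inner J v -> q22 d u v = 0) ->
  (forall u, inner I u -> q1 d u v0 - q1 d (u - 1) v0 = a *: q2 d u v0) ->
  forall u v, I u -> J v -> d u v = 0.
Proof.
move=> hI hJ [Iu0 Iu1 Jv0 Jv1] d00 d10 d01 d12 d22 d11.
have d2 u : I u -> q2 d u v0 = 0.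
  move: u; apply: (interval_ind u0) => //; first by rewrite /q2 d00 d01 subrr.
  move=> u Iu Iu'; suff -> : q2 d (u + 1) v0 = q2 d u v0 by [].
  apply: subr0_eq; rewrite -(d12 u v0) // /q12 /q2.
  by apply/rowP => i; rewrite !mxE; ring.
have dv0 u : I u -> d u v0 = 0.
  move: u; apply: (second_difference_eq0 u0) => // u Iu; have [_ Iu' _] := Iu.
  have := d11 u Iu; rewrite d2 // scaler0 /q1 subrK => /subr0_eq //.
move=> u v Iu Jv; apply: (second_difference_eq0 v0 hJ) (Jv) => //.
- exact: dv0.
- by rewrite -[LHS](subrK (d u v0)) -/(q2 d u v0) d2 // dv0 // addr0.
- move=> k Jk; have := d22 u k Iu Jk.
  by rewrite /q22 /q2 subrK => /subr0_eq.
Qed.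

End NormalizedNets.

(** * Characterization of congruence to a Cayley surface *)

Theorem theorem5p2 (R : realType) (I J : set int) (q : int -> int -> 'rV[R]_3)
    (hI : consecutive_integers I) (hI3 : `I_3 #<= I)
    (hJ : consecutive_integers J) (hJ2 : `I_2 #<= J)
    (hq : normalized_DIIAS I J q) :
  congruent_to_Cayley I J q <->
  (forall u v : int, inner I u -> J v -> cubic_coeff q u v != 0) /\
  (forall u v : int, inner I u -> inner I (u + 1) -> J v ->
     cubic_coeff_1 q u v = 0).
Proof.
(* The base vertex has [u0] inner, so that the cubic coefficient is meaningful there. *)
have [u0 u0I] := inner_exists hI hI3.
have [v0 [Jv0 Jv1]] := edge_exists hJ hJ2.
have [Iu0' Iu0 Iu1] := u0I.
have Q : quadrangle I J u0 v0 by split.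
split.
- move=> [a [a_neq0 [T [[L [b [_ TE]]] Tq]]]].
  have cE u v : I u -> J v -> cayley a u v = q u v *m L + b.
    by move=> Iu Jv; rewrite -TE Tq.
  have c1 u v : I u -> I (u + 1) -> J v -> q1 (cayley a) u v = q1 q u v *m L.
    by move=> *; rewrite /q1 !cE // mulmxBl opprD addrACA subrr addr0.
  have c2 : q2 (cayley a) u0 v0 = q2 q u0 v0 *m L.
    by rewrite /q2 !cE // mulmxBl opprD addrACA subrr addr0.
  (* The translation [b] cancels in [q12], which is [e3] for both nets. *)
  have c3 : e3 R = e3 R *m L.
    rewrite -{2}(normalized_q12 hq _ _ Q) -(cayley_q12 _ a u0 v0) /q12 !cE //.
    rewrite mulmxDl !mulmxBl.
    move: (_ *m L) (_ *m L) (_ *m L) (_ *m L) => x y z t.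
    by apply/rowP => i; rewrite !mxE; ring.
  have detL : \det L = 1.
    rewrite -[LHS]mul1r -{1}(normalized_det hq _ _ Q) -det3_mulmx -c1 // -c2 -c3.
    exact: cayley_det.
  have AE u v : inner I u -> J v -> cubic_coeff q u v = a.
    move=> [Iu' Iu Iu''] Jv; rewrite -[RHS](cayley_cubic_coeff _ a u v).
    by rewrite /cubic_coeff !c1 ?subrK // {2}c3 det3_mulmx detL mulr1.
  split=> [u v Iu Jv|u v Iu Iu' Jv]; first by rewrite AE.
  by rewrite /cubic_coeff_1 !AE // subrr.
- move=> [A_neq0 A1].
  pose a := cubic_coeff q u0 v0.
  have AE u : inner I u -> cubic_coeff q u v0 = a.
    move: u; apply: (interval_ind u0 (inner_interval hI)) => // u Iu Iu'.
    by have /subr0_eq -> := A1 u v0 Iu Iu' Jv0.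
  exists a; split; first exact: A_neq0.
  (* The determinant of this matrix is [det3] of its rows by conversion. *)
  pose frame p : 'M[R]_3 :=
    \matrix_(i < 3) [:: q1 p u0 v0; q2 p u0 v0; e3 R]`_i.
  have frame_q : \det (frame q) = 1 by exact: (normalized_det hq _ _ Q).
  have frame_c : \det (frame (cayley a)) = 1 by exact: cayley_det.
  pose L := invmx (frame q) *m frame (cayley a).
  have FL : frame q *m L = frame (cayley a).
    by rewrite mulKVmx // unitmxE frame_q unitr1.
  have L1 : q1 q u0 v0 *m L = q1 (cayley a) u0 v0.
    by have := congr1 (row 0) FL; rewrite row_mul !rowK.
  have L2 : q2 q u0 v0 *m L = q2 (cayley a) u0 v0.
    by have := congr1 (row 1) FL; rewrite row_mul !rowK.
  have L3 : e3 R *m L = e3 R.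
    by have := congr1 (row 2) FL; rewrite row_mul !rowK.
  pose b := cayley a u0 v0 - q u0 v0 *m L.
  exists (fun x => x *m L + b); split.
    exists L, b; split=> //.
    by rewrite unitmxE det_mulmx det_inv frame_q frame_c invr1 mul1r unitr1.
  (* The defect of the congruence; it vanishes at the base vertex by the choice of [b], and at its
     two neighbours by that of [L]. *)
  pose d u v := q u v *m L + b - cayley a u v.
  have d1 u v : q1 d u v = q1 q u v *m L - q1 (cayley a) u v.
    rewrite /q1 mulmxBl /d; move: (_ *m L) (_ *m L) => x y.
    by apply/rowP => i; rewrite !mxE; ring.
  have d2 u v : q2 d u v = q2 q u v *m L - q2 (cayley a) u v.
    rewrite /q2 mulmxBl /d; move: (_ *m L) (_ *m L) => x y.
    by apply/rowP => i; rewrite !mxE; ring.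
  have d00 : d u0 v0 = 0.
    by rewrite /d /b addrCA subrr addr0 subrr.
  move=> u v Iu Jv; apply: subr0_eq; rewrite -/(d u v).
  apply: (net_eq0 a u0 v0 hI hJ Q) => // {u v Iu Jv}.
  + by apply: subr0_eq; rewrite -[X in _ - X]d00 -/(q1 d u0 v0) d1 L1 subrr.
  + by apply: subr0_eq; rewrite -[X in _ - X]d00 -/(q2 d u0 v0) d2 L2 subrr.
  + move=> u v uv.
    have -> : q12 d u v = q12 q u v *m L - q12 (cayley a) u v.
      rewrite /q12 mulmxDl !mulmxBl /d.
      move: (_ *m L) (_ *m L) (_ *m L) (_ *m L) => x y z t.
      by apply/rowP => i; rewrite !mxE; ring.
    by rewrite (normalized_q12 hq) // cayley_q12 L3 subrr.
  + move=> u v Iu Jv; have [_ _ _ /(_ u v Iu Jv) q22_0] := hq.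
    rewrite /q22 !d2; move: q22_0 (cayley_q22 _ a u v).
    by rewrite /q22 => /subr0_eq -> /subr0_eq ->; rewrite subrr.
  + move=> u Iu; rewrite !d1 d2.
    have := normalized_q11 hq _ _ Iu Jv0 Jv1; rewrite AE //.
    (* Both nets satisfy the [q11] equation with the same [a], so their difference does too. *)
    have := cayley_q11 _ a u v0.
    move=> /(canRL (subrK _)) -> /(canRL (subrK _)) ->.
    rewrite mulmxDl -scalemxAl [RHS]scalerBr.
    by rewrite (opprD (a *: _)) addrACA addrK.
Qed.
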